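(* For every $K\in\mathcal{K}_0^n$ we have $\left(K^{\clubsuit}\right)^{\circ}=K'$.
   Context: A convex body in $\mathbb{R}^n$ is a closed convex set $K\subseteq\mathbb{R}^n$ with $0\in K$ (not assumed compact, nor with non-empty interior); $\mathcal{K}_0^n$ is the set of all convex bodies. The support function of $K$ is $h_K:S^{n-1}\to[0,\infty]$, $h_K(\theta)=\sup_{x\in K}\langle x,\theta\rangle$. A star set is a non-empty $A\subseteq\mathbb{R}^n$ such that $x\in A$ and $0\le\lambda\le1$ imply $\lambda x\in A$; its radial function is $r_A:S^{n-1}\to[0,\infty]$, $r_A(\theta)=\sup\{\lambda\ge0:\lambda\theta\in A\}$. A star body is a star set $A$ with $r_A(\theta)\theta\in A$ for all $\theta\in S^{n-1}$ with $r_A(\theta)<\infty$; it is uniquely determined by $r_A$. For $K\in\mathcal{K}_0^n$, the flower $K^{\clubsuit}$ of $K$ is the star body (not necessarily convex) with radial function $r_{K^{\clubsuit}}=h_K$. For any set $A\subseteq\mathbb{R}^n$, $A^\circ=\{y\in\mathbb{R}^n:\langle x,y\rangle\le 1\text{ for all }x\in A\}$. For $g:S^{n-1}\to[0,\infty]$, $A[g]=\{x\in\mathbb{R}^n:\langle x,\theta\rangle\le g(\theta)\text{ for all }\theta\in S^{n-1}\}$. The reciprocal body of $K\in\mathcal{K}_0^n$ is $K'=A[1/h_K]$, with $1/0=\infty$, $1/\infty=0$. *)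

(* Defs.v *)
From HB Require Import structures.
From mathcomp Require Import all_boot all_order all_algebra.
From mathcomp Require Import boolp classical_sets reals ereal topology.
From mathcomp Require Import normedtype convex.

Set Implicit Arguments.
Unset Strict Implicit.
Unset Printing Implicit Defensive.

Import Order.TTheory GRing.Theory Num.Theory.
Import numFieldNormedType.Exports.

Local Open Scope classical_set_scope.
Local Open Scope ring_scope.

Section Bodies.
Context {R : realType} {n : nat}.
Implicit Types (x y theta : 'rV[R]_n) (A K F : set 'rV[R]_n).

Definition dot x y : R := \sum_i x ord0 i * y ord0 i.

(* The norm that the library puts on row vectors is the sup norm. *)
Definition enorm x : R := Num.sqrt (dot x x).

Definition sphere : set 'rV[R]_n := [set theta | enorm theta = 1].

(* Closedness is for the product topology, the usual topology of R^n. *)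
Definition convex_body K : Prop :=
  [/\ closed K, convex_set K & K 0].

(* Functions on the sphere are represented by functions on 'rV[R]_n of which
   only the values on [sphere] are used. *)
Definition support_fun K : 'rV[R]_n -> \bar R :=
  fun theta => ereal_sup [set (dot x theta)%:E | x in K].

Definition star_set A : Prop :=
  A !=set0 /\ forall x (l : R), A x -> 0 <= l <= 1 -> A (l *: x).

Definition radial_fun A : 'rV[R]_n -> \bar R :=
  fun theta => ereal_sup [set l%:E | l in [set l : R | 0 <= l /\ A (l *: theta)]].

(* [fine] is only applied to finite values of the radial function. *)
Definition star_body A : Prop :=
  star_set A /\
  forall theta, sphere theta -> (radial_fun A theta < +oo)%E ->
    A (fine (radial_fun A theta) *: theta).

Definition has_radial_fun (g : 'rV[R]_n -> \bar R) A : Prop :=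
  forall theta, sphere theta -> radial_fun A theta = g theta.

(* The star body with radial function g; existence and uniqueness, for g
   nonnegative on the sphere, are [star_body_ofP] and [star_body_of_unique].
   The default value [set 0] is irrelevant. *)
Definition star_body_of (g : 'rV[R]_n -> \bar R) : set 'rV[R]_n :=
  xget [set 0] [set A | star_body A /\ has_radial_fun g A].

Definition flower K : set 'rV[R]_n := star_body_of (support_fun K).

Definition polar A : set 'rV[R]_n :=
  [set y | forall x, A x -> dot x y <= 1].

Definition alexandrov (g : 'rV[R]_n -> \bar R) : set 'rV[R]_n :=
  [set x | forall theta, sphere theta -> ((dot x theta)%:E <= g theta)%E].

(* The inverse on \bar R satisfies 0^-1 = +oo and +oo^-1 = 0. *)
Definition reciprocal K : set 'rV[R]_n :=
  alexandrov (fun theta => (support_fun K theta)^-1)%E.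

Lemma dotZZ (l : R) x : dot (l *: x) (l *: x) = l ^+ 2 * dot x x.
Proof.
rewrite /dot mulr_sumr; apply: eq_bigr => i _.
by rewrite !mxE expr2 mulrACA.
Qed.

Lemma dot_ge0 x : 0 <= dot x x.
Proof. by apply: sumr_ge0 => i _; rewrite -expr2 sqr_ge0. Qed.

Lemma enormZ (l : R) x : 0 <= l -> enorm (l *: x) = l * enorm x.
Proof.
by move=> l0; rewrite /enorm dotZZ sqrtrM ?sqr_ge0// sqrtr_sqr ger0_norm.
Qed.

Lemma enorm_eq0 x : enorm x = 0 -> x = 0.
Proof.
move=> /eqP; rewrite sqrtr_eq0 => dx.
have /eqP : dot x x = 0 by apply/eqP; rewrite eq_le dx dot_ge0.
rewrite psumr_eq0; last by move=> i _; rewrite -expr2 sqr_ge0.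
move=> /allP x0; apply/rowP => i; rewrite mxE.
by have := x0 i (mem_index_enum i); rewrite /= mulf_eq0 orbb => /eqP.
Qed.

Lemma polar_decomposition x : x != 0 ->
  exists r theta, [/\ 0 < r, sphere theta & x = r *: theta].
Proof.
move=> x0; have e0 : 0 < enorm x.
  rewrite lt_neqAle sqrtr_ge0 andbT eq_sym.
  by apply: contra_neq x0 => /enorm_eq0.
exists (enorm x), ((enorm x)^-1 *: x); split => //.
- by rewrite /sphere /= enormZ ?invr_ge0 ?ltW// mulVf// gt_eqF.
- by rewrite scalerA divff ?scale1r// gt_eqF.
Qed.

Lemma star_set0 A : star_set A -> A 0.
Proof. by move=> [[x Ax] sA]; rewrite -(scale0r x); apply: sA; rewrite // lexx ler01. Qed.

Lemma radial_fun_ge0 A theta : star_set A -> (0 <= radial_fun A theta)%E.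
Proof.
move=> sA; apply: ereal_sup_ubound; exists 0 => //=.
by split => //; rewrite scale0r; exact: star_set0.
Qed.

Lemma star_bodyE A (l : R) theta : star_body A -> sphere theta -> 0 <= l ->
  A (l *: theta) <-> (l%:E <= radial_fun A theta)%E.
Proof.
move=> [sA bA] th l0; split => [Al|].
  by apply: ereal_sup_ubound; exists l.
have shrink m : 0 <= m -> l <= m -> A (m *: theta) -> A (l *: theta).
  move=> m0 lm Am; have [m_eq0|mneq0] := eqVneq m 0.
    suff -> : l = m by [].
    by apply/eqP; rewrite eq_le lm m_eq0.
  have -> : l *: theta = (l / m) *: (m *: theta).
    by rewrite scalerA divfK.
  apply: sA.2 => //.
  have mp : 0 < m by rewrite lt_neqAle eq_sym mneq0.
  by rewrite divr_ge0//= ler_pdivrMr// mul1r.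
move=> lr; have [rlty|] := boolP (radial_fun A theta < +oo)%E.
  have r0 := radial_fun_ge0 theta sA.
  have rf : radial_fun A theta \is a fin_num by rewrite ge0_fin_numE.
  apply: (@shrink (fine (radial_fun A theta))).
  - exact: fine_ge0.
  - by rewrite -lee_fin fineK.
  - exact: bA.
rewrite -leNgt leye_eq => /eqP ry.
have /ereal_sup_gt[_ [m [m0 Am] <-] lm] : (l%:E < radial_fun A theta)%E.
  by rewrite ry ltry.
by apply: (@shrink m) => //; rewrite -lee_fin ltW.
Qed.

Lemma star_body_of_exists (g : 'rV[R]_n -> \bar R) :
  (forall theta, sphere theta -> (0 <= g theta)%E) ->
  exists A, star_body A /\ has_radial_fun g A.
Proof.
move=> g0.
pose A := [set x | x = 0 \/
  ((enorm x)%:E <= g ((enorm x)^-1 *: x))%E].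
have AE l theta : sphere theta -> 0 <= l ->
    A (l *: theta) <-> (l%:E <= g theta)%E.
  move=> th; rewrite le_eqVlt => /predU1P[<-|l0].
    by rewrite scale0r; split => _; [exact: g0|left].
  have el : enorm (l *: theta) = l by rewrite enormZ ?ltW// th mulr1.
  rewrite /A /= el scalerA mulVf ?gt_eqF// scale1r.
  split=> [[lt0|//]|]; last by right.
  by move: l0; rewrite -el lt0 /enorm /dot big1 ?sqrtr0 ?ltxx// => i _; rewrite mxE mul0r.
have rA theta : sphere theta -> radial_fun A theta = g theta.
  move=> th; apply/eqP; rewrite eq_le; apply/andP; split.
    by apply: ge_ereal_sup => _ /= [l [l0 Al] <-]; apply/AE.
  have rub l : 0 <= l -> (l%:E <= g theta)%E ->
      (l%:E <= radial_fun A theta)%E.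
    by move=> l0 lg; apply: ereal_sup_ubound; exists l => //; split => //; apply/AE.
  have := g0 _ th; case E : (g theta) => [r| |] //.
    by rewrite lee_fin => r0; apply: rub => //; rewrite E.
  move=> _; rewrite leye_eq; apply/eqP/eqyP => r r0.
  by apply: rub; [exact: ltW|rewrite E leey].
exists A; split=> //; split.
  split; first by exists 0; left.
  move=> x l Ax /andP[l0 l1]; have [->|x0] := eqVneq x 0.
    by rewrite scaler0; left.
  have [r [t [r0 tS xE]]] := polar_decomposition x0.
  rewrite xE scalerA; apply/AE => //; first by rewrite mulr_ge0// ltW.
  have /(AE _ _ tS (ltW r0)) : A (r *: t) by rewrite -xE.
  by apply: le_trans; rewrite lee_fin ler_piMl// ltW.
move=> theta th; rewrite rA// => glty; have gt0 := g0 _ th.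
by apply/AE => //; rewrite ?fine_ge0// fineK// ge0_fin_numE.
Qed.

Lemma star_body_unique A F : star_body A -> star_body F ->
  (forall theta, sphere theta -> radial_fun A theta = radial_fun F theta) ->
  A = F.
Proof.
move=> bA bF AF; apply/seteqP; split=> x; have [->|x0] := eqVneq x 0.
- by move=> _; exact: star_set0 bF.1.
- have [r [t [/ltW r0 tS ->]]] := polar_decomposition x0.
  by rewrite (star_bodyE bA tS r0) (star_bodyE bF tS r0) AF.
- by move=> _; exact: star_set0 bA.1.
- have [r [t [/ltW r0 tS ->]]] := polar_decomposition x0.
  by rewrite (star_bodyE bA tS r0) (star_bodyE bF tS r0) AF.
Qed.

Lemma star_body_ofP (g : 'rV[R]_n -> \bar R) :
  (forall theta, sphere theta -> (0 <= g theta)%E) ->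
  star_body (star_body_of g) /\ has_radial_fun g (star_body_of g).
Proof. by move=> /star_body_of_exists; exact: xgetPex. Qed.

Lemma star_body_of_unique (g : 'rV[R]_n -> \bar R) A :
  (forall theta, sphere theta -> (0 <= g theta)%E) ->
  star_body A -> has_radial_fun g A -> A = star_body_of g.
Proof.
move=> g0 bA rA; have [bF rF] := star_body_ofP g0.
by apply: star_body_unique => // theta th; rewrite rA// rF.
Qed.

Lemma support_fun_ge0 K theta : convex_body K -> (0 <= support_fun K theta)%E.
Proof.
move=> [_ _ K0]; apply: ereal_sup_ubound; exists 0 => //.
by rewrite /dot big1// => i _; rewrite mxE mul0r.
Qed.

Lemma flowerP K : convex_body K ->
  star_body (flower K) /\ has_radial_fun (support_fun K) (flower K).
Proof. by move=> bK; apply: star_body_ofP => theta _; exact: support_fun_ge0. Qed.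

End Bodies.

(* Main.v *)
Require Import Defs.
From mathcomp Require Import all_boot all_order all_algebra.
From mathcomp Require Import boolp classical_sets reals ereal topology.
From mathcomp Require Import normedtype convex.

(** The polar of a star body is cut out by its radial function alone: a point
    of a star body [A] other than the origin is [l *: theta] with [theta] on
    the sphere and [0 < l <= radial_fun A theta], so for fixed [theta] the
    constraints [l * dot theta y <= 1] over all such [l] collapse to the single
    one [dot y theta <= 1 / radial_fun A theta].  Hence the polar of [A] is the
    Alexandrov body of the inverse radial function ([polar_star_body]).  For the
    flower of [K] the radial function is the support function of [K], which
    turns this Alexandrov body into the reciprocal body. *)

Import Order.TTheory GRing.Theory Num.Theory.
Local Open Scope classical_set_scope.
Local Open Scope ring_scope.

Lemma dotC (R : realType) (n : nat) (x y : 'rV[R]_n) : dot x y = dot y x.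
Proof. by apply: eq_bigr => i _; rewrite mulrC. Qed.

Lemma dotZl (R : realType) (n : nat) (l : R) (x y : 'rV[R]_n) :
  dot (l *: x) y = l * dot x y.
Proof. by rewrite /dot mulr_sumr; apply: eq_bigr => i _; rewrite mxE mulrA. Qed.

(** The radius [h] and the inner product [c] along one ray.  The conventions
    [0^-1 = +oo] and [+oo^-1 = 0] are exactly what makes this hold on the whole
    range from 0 to +oo: a zero radius imposes nothing, an infinite one forces
    [c <= 0]. *)
Lemma le_inveP (R : realType) (h : \bar R) (c : R) : (0 <= h)%E ->
  (c%:E <= h^-1)%E <->
  (forall l : R, 0 <= l -> (l%:E <= h)%E -> l * c <= 1).
Proof.
move=> h0; have [c0|c0] := leP c 0.
  split=> [_ l l0 _|_]; first by rewrite (le_trans (mulr_ge0_le0 l0 c0)).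
  by apply: (@le_trans _ _ 0%E); rewrite ?lee_fin// inve_ge0.
have c_ge0 : (0 <= c%:E)%E by rewrite lee_fin ltW.
rewrite inve_pge// inver gt_eqF//; split=> [hc l _ lh|H].
  by have := le_trans lh hc; rewrite lee_fin -ler_pdivlMr// div1r.
case: h h0 H => [r| |] // h0 H.
  by rewrite lee_fin -div1r ler_pdivlMr//; apply: H; rewrite -?lee_fin.
(* Along a ray contained in the body, any [l > c^-1] violates the bound. *)
have := H (2 / c) (divr_ge0 (ler0n _ 2) (ltW c0)) (leey _).
by rewrite divfK ?gt_eqF// (ler_nat _ 2 1).
Qed.

Lemma polar_star_body (R : realType) (n : nat) (A : set 'rV[R]_n) :
  star_body A ->
  polar A = alexandrov (fun theta => (radial_fun A theta)^-1)%E.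
Proof.
move=> bA; have r_ge0 theta := radial_fun_ge0 theta bA.1.
apply/seteqP; split=> y yA.
  move=> theta th; apply/le_inveP => // l l0 /(star_bodyE bA th l0) Al.
  by rewrite dotC -dotZl; exact: yA.
move=> x Ax; have [x0|x0] := eqVneq x 0.
  by rewrite x0 -(scale0r 0) dotZl mul0r ler01.
have [l [theta [/ltW l0 th xE]]] := polar_decomposition x0.
move: Ax; rewrite xE => /(star_bodyE bA th l0) lr.
rewrite dotZl dotC.
exact: (proj1 (le_inveP _ _ _ (r_ge0 theta)) (yA _ th)).
Qed.

Theorem proposition6 (R : realType) (n : nat) (K : set 'rV[R]_n)
  (hK : convex_body K) : polar (flower K) = reciprocal K.
Proof.
have [bF rF] := flowerP hK; rewrite polar_star_body//.
(* The radial and support functions agree on the sphere only. *)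
by apply/seteqP; split=> y yF theta th; have := yF _ th; rewrite /= rF.
Qed.
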